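(* Let $\zeta,\varsigma,\tau,\delta\in\mathbb{T}$ with $|\operatorname{Im}_j(\varsigma)|<\operatorname{Re}(\varsigma)$. (i) If $|\operatorname{Im}_j(\tau)|<\operatorname{Re}(\tau)$, then $$\zeta\,\mathbb{E}^{\delta}_{\varsigma,\varsigma+\tau}(\zeta)=\mathbb{E}^{\delta}_{\varsigma,\tau}(\zeta)-\mathbb{E}^{\delta-1}_{\varsigma,\tau}(\zeta).$$ (ii) If $|\operatorname{Im}_j(\tau)|<\operatorname{Re}(\tau)-1$, then $$(\tau-\varsigma\delta-1)\,\mathbb{E}^{\delta}_{\varsigma,\tau}(\zeta)=\mathbb{E}^{\delta}_{\varsigma,\tau-1}(\zeta)-\varsigma\delta\,\mathbb{E}^{\delta+1}_{\varsigma,\tau}(\zeta).$$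
   Context: $\mathbb{T}=\{x_0+i_1x_1+i_2x_2+jx_3: x_0,\dots,x_3\in\mathbb{R}\}$ is the commutative algebra of bicomplex numbers, with $i_1^2=i_2^2=-1$, $j=i_1i_2=i_2i_1$, $j^2=1$; write $\operatorname{Re}=x_0$, $\operatorname{Im}_j=x_3$. $\mathbb{C}$ is identified with $\{x_0+i_1x_1\}$. With $e_1=\frac{1+i_1i_2}{2}$, $e_2=\frac{1-i_1i_2}{2}$, every $\xi=w_1+i_2w_2$ ($w_1,w_2\in\mathbb{C}$) is uniquely $\xi=\xi_1e_1+\xi_2e_2$ with $\xi_1=w_1-i_1w_2$, $\xi_2=w_1+i_1w_2\in\mathbb{C}$; algebraic operations, limits and $\Gamma$ are componentwise, $\Gamma(\xi)=\Gamma(\xi_1)e_1+\Gamma(\xi_2)e_2$. The bicomplex Prabhakar function (for $|\operatorname{Im}_j(\varsigma)|<\operatorname{Re}(\varsigma)$, $|\operatorname{Im}_j(\tau)|<\operatorname{Re}(\tau)$) is $$\mathbb{E}_{\varsigma,\tau}^{\delta}(\zeta)=\sum_{k=0}^{\infty}\frac{(\delta)_k}{k!\,\Gamma(\varsigma k+\tau)}\zeta^k,\qquad (\delta)_k=\delta(\delta+1)\cdots(\delta+k-1),\ (\delta)_0=1.$$ *)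

(* Defs.v *)
From HB Require Import structures.
From mathcomp Require Import all_boot all_order all_algebra.
From mathcomp Require Import complex ring.
From mathcomp Require Import all_classical all_reals all_analysis.
Set Implicit Arguments.
Unset Strict Implicit.
Unset Printing Implicit Defensive.
Import Order.TTheory GRing.Theory Num.Theory.
Import numFieldNormedType.Exports.
Local Open Scope ring_scope.

(* [Bicomplex x0 x1 x2 x3] is x0 + i1 x1 + i2 x2 + j x3. *)
Record bicomplex (R : Type) : Type :=
  Bicomplex { bRe : R; bIm1 : R; bIm2 : R; bImj : R }.

Section BicomplexEqChoice.
Variable R : Type.

Definition prod_of_bicomplex (x : bicomplex R) : R * R * R * R :=
  (bRe x, bIm1 x, bIm2 x, bImj x).
Definition bicomplex_of_prod (p : R * R * R * R) : bicomplex R :=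
  let: (x0, x1, x2, x3) := p in Bicomplex x0 x1 x2 x3.

Lemma prod_of_bicomplexK : cancel prod_of_bicomplex bicomplex_of_prod.
Proof. by case. Qed.

End BicomplexEqChoice.

HB.instance Definition _ (R : eqType) := Equality.copy (bicomplex R)
  (can_type (@prod_of_bicomplexK R)).
HB.instance Definition _ (R : choiceType) := Choice.copy (bicomplex R)
  (can_type (@prod_of_bicomplexK R)).

Section BicomplexRing.
Variable R : rcfType.
Implicit Types x y z : bicomplex R.

Definition addb x y :=
  let: Bicomplex x0 x1 x2 x3 := x in let: Bicomplex y0 y1 y2 y3 := y in
  Bicomplex (x0 + y0) (x1 + y1) (x2 + y2) (x3 + y3).
Definition oppb x :=
  let: Bicomplex x0 x1 x2 x3 := x in Bicomplex (- x0) (- x1) (- x2) (- x3).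
Definition zerob : bicomplex R := Bicomplex 0 0 0 0.
Definition oneb : bicomplex R := Bicomplex 1 0 0 0.

(* i1^2 = i2^2 = -1, i1 i2 = i2 i1 = j, hence i1 j = - i2, i2 j = - i1 and
   j^2 = 1. *)
Definition mulb x y :=
  let: Bicomplex x0 x1 x2 x3 := x in let: Bicomplex y0 y1 y2 y3 := y in
  Bicomplex (x0 * y0 - x1 * y1 - x2 * y2 + x3 * y3)
            (x0 * y1 + x1 * y0 - x2 * y3 - x3 * y2)
            (x0 * y2 + x2 * y0 - x1 * y3 - x3 * y1)
            (x0 * y3 + x3 * y0 + x1 * y2 + x2 * y1).

Fact addbA : associative addb.
Proof. by move=> [????] [????] [????] /=; rewrite !addrA. Qed.
Fact addbC : commutative addb.
Proof. by move=> [????] [????] /=; congr Bicomplex; rewrite addrC. Qed.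
Fact add0b : left_id zerob addb.
Proof. by move=> [????] /=; rewrite !add0r. Qed.
Fact addNb : left_inverse zerob oppb addb.
Proof. by move=> [????] /=; rewrite !addNr. Qed.

HB.instance Definition _ :=
  GRing.isZmodule.Build (bicomplex R) addbA addbC add0b addNb.

Fact mulbA : associative mulb.
Proof. by move=> [????] [????] [????] /=; congr Bicomplex; ring. Qed.
Fact mulbC : commutative mulb.
Proof. by move=> [????] [????] /=; congr Bicomplex; ring. Qed.
Fact mul1b : left_id oneb mulb.
Proof. by move=> [????] /=; congr Bicomplex; ring. Qed.
Fact mulbDl : left_distributive mulb addb.
Proof. by move=> [????] [????] [????] /=; congr Bicomplex; ring. Qed.
Fact oneb_neq0 : oneb != zerob.
Proof. by apply/eqP => -[/eqP]; rewrite oner_eq0. Qed.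

HB.instance Definition _ := GRing.Zmodule_isComNzRing.Build (bicomplex R)
  mulbA mulbC mul1b mulbDl oneb_neq0.

(* The field of complex numbers is identified with {x0 + i1 x1}. *)
Definition bicomplex_of_complex (w : R[i]) : bicomplex R :=
  Bicomplex (complex.Re w) (complex.Im w) 0 0.

Definition bi1 : bicomplex R := Bicomplex 0 1 0 0.
Definition bi2 : bicomplex R := Bicomplex 0 0 1 0.
Definition be1 : bicomplex R := Bicomplex 2^-1 0 0 2^-1.
Definition be2 : bicomplex R := Bicomplex 2^-1 0 0 (- 2^-1).

Lemma be1E : be1 *+ 2 = 1 + bi1 * bi2.
Proof.
apply: (can_inj (@prod_of_bicomplexK R)).
by rewrite /prod_of_bicomplex /=; congr (_, _, _, _); field.
Qed.

Lemma be2E : be2 *+ 2 = 1 - bi1 * bi2.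
Proof.
apply: (can_inj (@prod_of_bicomplexK R)).
by rewrite /prod_of_bicomplex /=; congr (_, _, _, _); field.
Qed.

(* For x = w1 + i2 w2 with w1 = x0 + i1 x1 and w2 = x2 + i1 x3, the idempotent
   components are w1 - i1 w2 and w1 + i1 w2. *)
Definition idem1 x : R[i] := Complex (bRe x + bImj x) (bIm1 x - bIm2 x).
Definition idem2 x : R[i] := Complex (bRe x - bImj x) (bIm1 x + bIm2 x).

Definition of_idem (z1 z2 : R[i]) : bicomplex R :=
  bicomplex_of_complex z1 * be1 + bicomplex_of_complex z2 * be2.

Lemma idem1K (z1 z2 : R[i]) : idem1 (of_idem z1 z2) = z1.
Proof. by case: z1 z2 => [??] [??]; rewrite /idem1 /=; congr Complex; field. Qed.

Lemma idem2K (z1 z2 : R[i]) : idem2 (of_idem z1 z2) = z2.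
Proof. by case: z1 z2 => [??] [??]; rewrite /idem2 /=; congr Complex; field. Qed.

Lemma of_idemK x : of_idem (idem1 x) (idem2 x) = x.
Proof.
case: x => x0 x1 x2 x3; apply: (can_inj (@prod_of_bicomplexK R)).
by rewrite /prod_of_bicomplex /=; congr (_, _, _, _); field.
Qed.

Lemma idem1M x y : idem1 (x * y) = idem1 x * idem1 y.
Proof. by case: x y => [????] [????]; rewrite /idem1 /=; congr Complex; ring. Qed.

Lemma idem2M x y : idem2 (x * y) = idem2 x * idem2 y.
Proof. by case: x y => [????] [????]; rewrite /idem2 /=; congr Complex; ring. Qed.

Lemma idem1_1 : idem1 1 = 1.
Proof. by rewrite /idem1 /= addr0 subr0. Qed.

Lemma idem2_1 : idem2 1 = 1.
Proof. by rewrite /idem2 /= subr0 addr0. Qed.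

(* Inverses are taken componentwise; by the library's convention, a non-unit
   is its own inverse. *)
Definition unitb x := (idem1 x != 0) && (idem2 x != 0).
Definition invb x :=
  if unitb x then of_idem (idem1 x)^-1 (idem2 x)^-1 else x.

Fact mulVb : {in unitb, left_inverse 1 invb *%R}.
Proof.
move=> x xu; rewrite /invb [unitb x]xu; case/andP: xu => x1 x2.
rewrite -[LHS]of_idemK -[RHS]of_idemK idem1M idem2M idem1K idem2K.
by rewrite !mulVf// idem1_1 idem2_1.
Qed.
Fact unitbPl x y : y * x = 1 -> unitb x.
Proof.
move=> yx1; apply/andP; split; apply/eqP => x0.
- by move/eqP: (congr1 idem1 yx1); rewrite idem1M idem1_1 x0 mulr0 eq_sym oner_eq0.
- by move/eqP: (congr1 idem2 yx1); rewrite idem2M idem2_1 x0 mulr0 eq_sym oner_eq0.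
Qed.
Fact invb_out : {in [predC unitb], invb =1 id}.
Proof. by move=> x /negbTE xu; rewrite /invb; move: xu; rewrite -topredE /= => ->. Qed.

HB.instance Definition _ :=
  GRing.ComNzRing_hasMulInverse.Build (bicomplex R) mulVb unitbPl invb_out.

End BicomplexRing.

Section Prabhakar.
Variable R : realType.

Definition cexp (z : R[i]) : R[i] :=
  Complex (expR (complex.Re z) * cos (complex.Im z))
          (expR (complex.Re z) * sin (complex.Im z)).

(* n ^ z = exp (z ln n), for n > 0. *)
Definition cpow_nat (n : nat) (z : R[i]) : R[i] := cexp (z * (ln n%:R)%:C%C).

(* Euler's limit formula for the complex Gamma function,
     Gamma z = lim_n n! n^z / (z (z + 1) ... (z + n)),
   valid at every z outside {0, -1, -2, ...}. *)
Definition cGamma (z : R[i]) : R[i] :=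
  limn (fun n : nat =>
    (n`!%:R * cpow_nat n z / \prod_(k < n.+1) (z + k%:R)) : R[i]^o).

Definition bGamma (x : bicomplex R) : bicomplex R :=
  of_idem (cGamma (idem1 x)) (cGamma (idem2 x)).

Definition blim (u : nat -> bicomplex R) : bicomplex R :=
  of_idem (limn (fun n => idem1 (u n) : R[i]^o))
          (limn (fun n => idem2 (u n) : R[i]^o)).

Definition pochhammer (d : bicomplex R) (k : nat) : bicomplex R :=
  \prod_(i < k) (d + i%:R).

Definition prabhakar (s t d z : bicomplex R) : bicomplex R :=
  blim (series (fun k =>
    pochhammer d k / (k`!%:R * bGamma (s * k%:R + t)) * z ^+ k)).

End Prabhakar.

(* Main.v *)
(* In the idempotent coordinates every operation splits into two complex ones,
   so both identities reduce to the complex Prabhakar function with Re s > 0 and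
   Re t > 0. There they hold term by term: (i), up to an index shift, is
   (d)_k - (d - 1)_k = k (d)_(k-1), and (ii) is d (d + 1)_k = (d)_k (d + k)
   combined with Gamma (w + 1) = w Gamma w.

   Since limits are total functions, all limits involved must be shown to exist.
   Euler's sequence for Gamma converges because its successive ratios are
   1 + O(1/n^2). The series converges because, for every K,
     1 / |Gamma w| <= (|w| + K)^(K+1) exp ((c^2 - ln K) Re w)
   on each cone |Im w| <= c Re w, so that Gamma (s k + t) grows faster than any
   geometric sequence although s is not real. *)
Require Import Defs.
From HB Require Import structures.
From mathcomp Require Import all_boot all_order all_algebra.
From mathcomp Require Import complex ring lra.
From mathcomp Require Import all_classical all_reals all_analysis.
Set Implicit Arguments.
Unset Strict Implicit.
Unset Printing Implicit Defensive.
Import Order.TTheory GRing.Theory Num.Theory.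
Import numFieldNormedType.Exports.
Import complex.ComplexField.Normc.
Local Open Scope ring_scope.

(** * Modulus, real and imaginary parts of complex numbers *)

Section ComplexModulus.
Variable R : rcfType.
Implicit Types (x y : R) (z w : R[i]).

Lemma normc_ge0 z : 0 <= normc z.
Proof. by case: z => a b; exact: sqrtr_ge0. Qed.

Lemma normc_eq0 z : (normc z == 0) = (z == 0).
Proof. by apply/eqP/eqP => [/eq0_normc//|->]; exact: normc0. Qed.

Lemma normc_gt0 z : (0 < normc z) = (z != 0).
Proof. by rewrite lt_neqAle normc_ge0 andbT eq_sym normc_eq0. Qed.

Lemma ler_normcD z w : normc (z + w) <= normc z + normc w.
Proof. exact: (@le_normcD R z w). Qed.

Lemma normc_opp z : normc (- z) = normc z.
Proof. exact: (@normcN R z). Qed.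

Lemma normcR x : normc x%:C%C = `|x|.
Proof. by rewrite /normc /= expr0n addr0 sqrtr_sqr. Qed.

Lemma normc_nat n : normc (n%:R : R[i]) = n%:R.
Proof.
have -> : (n%:R : R[i]) = (n%:R : R)%:C%C by rewrite rmorph_nat.
by rewrite normcR normr_nat.
Qed.

Lemma normcX z n : normc (z ^+ n) = normc z ^+ n.
Proof.
elim: n => [|n IH]; first by rewrite !expr0 normc1.
by rewrite !exprS normcM IH.
Qed.

Lemma normc_prod n (F : nat -> R[i]) :
  normc (\prod_(k < n) F k) = \prod_(k < n) normc (F k).
Proof.
elim: n => [|n IH]; first by rewrite !big_ord0 normc1.
by rewrite !big_ord_recr /= normcM IH.
Qed.

Lemma normc_le_ReIm z : normc z <= `|complex.Re z| + `|complex.Im z|.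
Proof.
case: z => a b /=; rewrite -(ler_pXn2r (n := 2)) ?nnegrE ?sqrtr_ge0 ?addr_ge0//.
rewrite sqr_sqrtr ?addr_ge0 ?sqr_ge0// -[a ^+ 2]real_normK ?num_real//.
rewrite -[b ^+ 2]real_normK ?num_real//.
by have := normr_ge0 a; have := normr_ge0 b; nra.
Qed.

Lemma normc_ge_absRe z : `|complex.Re z| <= normc z.
Proof.
case: z => a b /=; rewrite -sqrtr_sqr ler_wsqrtr// lerDl sqr_ge0//.
Qed.

Lemma normc_ge_absIm z : `|complex.Im z| <= normc z.
Proof.
case: z => a b /=; rewrite -sqrtr_sqr ler_wsqrtr// lerDr sqr_ge0//.
Qed.

Lemma Re_le_normc z : complex.Re z <= normc z.
Proof. exact: le_trans (ler_norm _) (normc_ge_absRe z). Qed.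

Lemma ReD z w : complex.Re (z + w) = complex.Re z + complex.Re w.
Proof. by case: z w => [? ?] [? ?]. Qed.

Lemma ImD z w : complex.Im (z + w) = complex.Im z + complex.Im w.
Proof. by case: z w => [? ?] [? ?]. Qed.

Lemma Re_nat n : complex.Re (n%:R : R[i]) = n%:R.
Proof. by rewrite -(rmorph_nat (real_complex R)). Qed.

Lemma ReMn z n : complex.Re (z * n%:R) = complex.Re z * n%:R.
Proof. by rewrite -(rmorph_nat (real_complex R)); case: z => a b /=; ring. Qed.

Lemma ImMn z n : complex.Im (z * n%:R) = complex.Im z * n%:R.
Proof. by rewrite -(rmorph_nat (real_complex R)); case: z => a b /=; ring. Qed.

End ComplexModulus.

(** * Convergence criteria for complex sequences and series *)

Section ComplexLimits.
Variable R : realType.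
Implicit Types (u v : nat -> R[i]^o) (l : R[i]^o) (e : nat -> R).
Local Open Scope classical_set_scope.

Lemma cvgc_of_le u l e : (forall n, normc (u n - l) <= e n) ->
  e @ \oo --> 0 -> u @ \oo --> l.
Proof.
move=> ule /cvgrPdist_lt e0; apply/cvgrPdist_lt => eps.
(* The order on [R[i]] only compares numbers with equal imaginary parts, so a positive [eps] is real
   and the claim becomes one about its real part. *)
rewrite ltcE /= => /andP[/eqP i0 r0].
near=> n.
have en : `|0 - e n| < complex.Re eps by near: n; exact: e0.
rewrite -normrN opprB.
change (((normc (u n - l))%:C)%C < eps).
rewrite ltcE /= i0 eqxx /=; apply: le_lt_trans (ule n) _; apply: le_lt_trans en.
by rewrite sub0r normrN ler_norm.
Unshelve. all: by end_near.
Qed.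

Lemma normc_cvg_ge u l (c : R) N : u @ \oo --> l ->
  (forall n, (N <= n)%N -> c <= normc (u n)) -> c <= normc l.
Proof.
move=> /cvgrPdist_lt ul cu; rewrite leNgt; apply/negP => lc.
have d0 : 0 < ((c - normc l)%:C)%C :> R[i] by rewrite ltcR subr_gt0.
have [M _ HM] := ul _ d0.
have := HM (maxn M N) (leq_maxl _ _); rewrite /= -normrN opprB.
change (((normc (u (maxn M N) - l))%:C)%C < ((c - normc l)%:C)%C -> False).
rewrite ltcR => h.
have := cu _ (leq_maxr M N); have := ler_normcD (u (maxn M N) - l) l.
rewrite subrK; lra.
Qed.

Lemma cvgc_ReIm u (a b : R) : (fun n => complex.Re (u n)) @ \oo --> a ->
  (fun n => complex.Im (u n)) @ \oo --> b -> u @ \oo --> (Complex a b : R[i]^o).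
Proof.
move=> ua ub.
apply: (@cvgc_of_le _ _ (fun n => `|complex.Re (u n) - a| + `|complex.Im (u n) - b|)).
  move=> n; apply: le_trans (normc_le_ReIm _) _.
  by case: (u n).
have -> : (0 : R) = `|a - a| + `|b - b| by rewrite !subrr normr0 addr0.
apply: cvgD; apply: cvg_norm; apply: cvgB => //; exact: cvg_cst.
Qed.

Lemma Re_series u n : complex.Re (series u n) = series (fun k => complex.Re (u k)) n.
Proof.
elim: n => [|n IH]; first by rewrite /series /= !big_geq.
by rewrite !seriesSr ReD IH.
Qed.

Lemma Im_series u n : complex.Im (series u n) = series (fun k => complex.Im (u k)) n.
Proof.
elim: n => [|n IH]; first by rewrite /series /= !big_geq.
by rewrite !seriesSr ImD IH.
Qed.

(** The real and imaginary parts are bounded by the modulus, so the real comparison test applies to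
    each of them, and the two limits are recombined. *)
Lemma is_cvgc_series u e : (forall n, normc (u n) <= e n) ->
  cvgn (series e) -> cvgn (series u).
Proof.
move=> ue ce.
have cvr (v : nat -> R) : (forall n, `|v n| <= e n) -> cvgn (series v).
  move=> ve; apply: normed_cvg; apply: series_le_cvg ce => //= n.
  exact: le_trans (ve n).
have cR : cvgn (series (fun k => complex.Re (u k))).
  by apply: cvr => n; exact: le_trans (normc_ge_absRe _) (ue n).
have cI : cvgn (series (fun k => complex.Im (u k))).
  by apply: cvr => n; exact: le_trans (normc_ge_absIm _) (ue n).
apply/cvg_ex; eexists; apply: cvgc_ReIm.
  by under eq_fun do rewrite Re_series; exact: cR.
by under eq_fun do rewrite Im_series; exact: cI.
Qed.

Lemma cvgc_lim u l : u @ \oo --> l -> limn u = l.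
Proof. by move=> /cvg_lim; apply; exact: norm_hausdorff. Qed.

Lemma cvgc_unique u l l' : u @ \oo --> l -> u @ \oo --> l' -> l = l'.
Proof. by move=> /cvgc_lim <- /cvgc_lim. Qed.

Lemma cvgcB u v l l' : u @ \oo --> l -> v @ \oo --> l' ->
  (fun n => u n - v n) @ \oo --> l - l'.
Proof. by move=> ul vl; exact: (cvgB ul vl). Qed.

Lemma cvgcM u v l l' : u @ \oo --> l -> v @ \oo --> l' ->
  (fun n => u n * v n : R[i]^o) @ \oo --> (l * l' : R[i]^o).
Proof. by move=> ul vl; exact: (cvgM ul vl). Qed.

Lemma cvgcMl c u l : u @ \oo --> l ->
  (fun n => c * u n : R[i]^o) @ \oo --> (c * l : R[i]^o).
Proof. by move=> ul; exact: (cvgcM (cvg_cst _) ul). Qed.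

Lemma cvgcS u l : u @ \oo --> l -> (fun n => u n.+1) @ \oo --> l.
Proof. by rewrite -cvg_shiftS. Qed.

(* The hypothesis makes [normc (u n) * expR (D / n.+1)] nonincreasing, so [u] is
   bounded and its increments are dominated by a telescoping series. *)
Lemma is_cvgc_ratio u (D : R) : 0 <= D ->
  (forall n, normc (u n.+1 - u n) <= D * (n.+1%:R^-1 - n.+2%:R^-1) * normc (u n)) ->
  cvgn u.
Proof.
move=> D0 hu.
have inc n : 0 <= n.+1%:R^-1 - n.+2%:R^-1 :> R.
  by rewrite subr_ge0 lef_pV2 ?posrE ?ltr0n// ler_nat.
have bound n : normc (u n) * expR (D / n.+1%:R) <= normc (u 0%N) * expR D.
  elim: n => [|n IH]; first by rewrite divr1.
  apply: le_trans IH.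
  have -> : D / n.+1%:R = D * (n.+1%:R^-1 - n.+2%:R^-1) + D / n.+2%:R by ring.
  rewrite expRD mulrA ler_wpM2r ?expR_ge0//.
  have := ler_normcD (u n.+1 - u n) (u n); rewrite subrK => h.
  apply: le_trans h _.
  apply: (@le_trans _ _
    (normc (u n) * (1 + D * (n.+1%:R^-1 - n.+2%:R^-1)))).
    by rewrite mulrDr mulr1 addrC lerD2l mulrC hu.
  by rewrite ler_wpM2l ?normc_ge0 ?expR_ge1Dx.
have bound' n : normc (u n) <= normc (u 0%N) * expR D.
  apply: le_trans (bound n); rewrite ler_peMr ?normc_ge0//.
  apply: le_trans (expR_ge1Dx _); rewrite lerDl divr_ge0//.
set B := normc (u 0%N) * expR D in bound'.
pose h n : R := - (D * B) * n.+1%:R^-1.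
have ch : cvgn (series (telescope h)).
  have -> : series (telescope h) = (fun n => h n - h 0%N).
    apply/funext => n; rewrite /telescope /series /= telescope_sumr//.
  apply: is_cvgB; last exact: is_cvg_cst.
  apply: is_cvgM; first exact: is_cvg_cst.
  by apply/cvg_ex; exists 0; exact: cvg_harmonic.
have cu : cvgn (series (telescope u)).
  apply: is_cvgc_series ch => n; apply: le_trans (hu n) _.
  have -> : telescope h n = h n.+1 - h n by [].
  have -> : h n.+1 - h n = D * (n.+1%:R^-1 - n.+2%:R^-1) * B.
    by rewrite /h; ring.
  by rewrite ler_wpM2l// mulr_ge0.
have -> : u = series (telescope u) + cst (u 0%N).
  apply/funext => n; rewrite /telescope /series /= addrfctE telescope_sumr//.
  by rewrite subrK.
apply: (is_cvgD cu).
exact: is_cvg_cst.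
Qed.

End ComplexLimits.

(** * The complex exponential and its first-order Taylor estimate *)

Section Exponential.
Variable R : realType.
Implicit Types (x y : R) (z w : R[i]).

Lemma normr_sin_le x : `|sin x| <= `|x|.
Proof.
wlog x0 : x / 0 <= x.
  move=> H; have [/H//|/ltW x0] := leP 0 x.
  by rewrite -[`|sin x|]normrN -sinN -[`|x|]normrN; apply: H; rewrite oppr_ge0.
have [c _ ] := @MVT_segment R sin cos 0 x x0 (fun x _ => is_derive_sin x)
  (@continuous_subspaceT _ _ _ _ (@continuous_sin R)).
rewrite sin0 !subr0 => ->; rewrite normrM ler_piMl// ler_norml.
by rewrite cos_geN1 cos_le1.
Qed.

Lemma oneBcos_le x : 0 <= 1 - cos x <= x ^+ 2 / 2.
Proof.
rewrite subr_ge0 cos_le1 /=.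
have -> : 1 - cos x = sin (x / 2) ^+ 2 *+ 2.
  rewrite {1}(_ : x = (x / 2) *+ 2); last by rewrite -mulr_natr; field.
  by rewrite cos_mulr2n cos2sin2; ring.
have : sin (x / 2) ^+ 2 <= (x / 2) ^+ 2.
  rewrite -[leLHS]real_normK ?num_real// -[leRHS]real_normK ?num_real//.
  by rewrite ler_pXn2r// ?nnegrE// normr_sin_le.
rewrite expr_div_n; lra.
Qed.

Lemma normr_sinB_le x : `|sin x - x| <= x ^+ 2.
Proof.
wlog x0 : x / 0 <= x.
  move=> H; have [/H//|/ltW x0] := leP 0 x.
  by have := H (- x); rewrite sinN sqrrN -opprD normrN oppr_ge0; apply.
have d y : y \in `]0, x[ -> is_derive y 1 (fun y => sin y - y) (cos y - 1).
  by move=> _; apply: is_deriveB.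
have [|c /[!in_itv]/= /andP[c0 cx]] := MVT_segment x0 d.
  by apply: continuous_subspaceT => y; apply: cvgB; [exact: continuous_sin|exact: cvg_id].
rewrite sin0 !subr0 => ->; rewrite normrM (ger0_norm x0) expr2 ler_wpM2r//.
have c1 : `|cos c - 1| = 1 - cos c.
  by rewrite distrC ger0_norm// subr_ge0 cos_le1.
rewrite c1; have /andP[_ h] := oneBcos_le c.
(* The goal is [1 - cos c <= x]. If [c <= 2], then [c ^+ 2 / 2 <= c <= x]; otherwise
   [1 - cos c <= 2 < c <= x]. *)
have [c2|c2] := leP c 2; first by apply: le_trans cx; apply: le_trans h _; nra.
by have := cos_geN1 c; lra.
Qed.

Lemma expRB1_bounds x : 0 <= expR x - 1 - x <= x ^+ 2 * expR `|x|.
Proof.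
have h1 := expR_ge1Dx x; apply/andP; split; first lra.
have h2 := expR_ge1Dx (- x).
have E : expR x * expR (- x) = 1 by rewrite -expRD subrr expR0.
have p := expR_gt0 x.
(* This is [1 - x <= expR (- x)] multiplied by [expR x]. With [x <= expR x - 1] it bounds
   [x * (expR x - 1)], which dominates [expR x - 1 - x], for either sign of [x]. *)
have h3 : expR x - 1 <= x * expR x by nra.
have [x0|x0] := leP 0 x; first by rewrite ger0_norm//; nra.
have : 1 <= expR `|x| by apply: le_trans (expR_ge1Dx _); rewrite lerDl.
by move=> h4; apply: (@le_trans _ _ (x ^+ 2)); nra.
Qed.

Lemma cexpD z w : cexp (z + w) = cexp z * cexp w.
Proof.
case: z w => [a b] [c d]; rewrite /cexp /= expRD cosD sinD.
by congr Complex; ring.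
Qed.

Lemma cexp_real x : cexp x%:C%C = (expR x)%:C%C.
Proof. by rewrite /cexp /= cos0 sin0 mulr1 mulr0. Qed.

Lemma normc_cexp z : normc (cexp z) = expR (complex.Re z).
Proof.
case: z => a b; rewrite /cexp /= !exprMn -mulrDr cos2Dsin2 mulr1.
by rewrite sqrtr_sqr ger0_norm// expR_ge0.
Qed.

(** With [z = a + ib], the real part of the remainder is (e^a - 1 - a) - e^a (1 - cos b) and the
    imaginary part is (e^a - 1) sin b + (sin b - b). Each piece is of second order by the
    one-variable estimates. *)
Lemma cexp_taylor1 z :
  normc (cexp z - 1 - z) <= 2 * normc z ^+ 2 * expR (normc z).
Proof.
have nz2 : normc z ^+ 2 = complex.Re z ^+ 2 + complex.Im z ^+ 2.
  by case: z => a b /=; rewrite sqr_sqrtr// addr_ge0// sqr_ge0.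
have aE := normc_ge_absRe z; have n0 := normc_ge0 z.
apply: le_trans (normc_le_ReIm _) _; rewrite {}nz2.
have {aE}: expR `|complex.Re z| <= expR (normc z) by rewrite ler_expR.
move: (expR (normc z)) => N.
have -> : complex.Re (cexp z - 1 - z)
    = expR (complex.Re z) * cos (complex.Im z) - 1 - complex.Re z.
  by case: z {n0} => a b /=.
have -> : complex.Im (cexp z - 1 - z)
    = expR (complex.Re z) * sin (complex.Im z) - complex.Im z.
  by case: z {n0} => a b /=; rewrite subr0.
move: (complex.Re z) (complex.Im z) => a b EN {n0}.
have E1 : 1 <= expR `|a| by apply: le_trans (expR_ge1Dx _); rewrite lerDl.
have Ea : expR a <= expR `|a| by rewrite ler_expR ler_norm.
have Ea0 := expR_gt0 a.
have /andP[B0 B] := expRB1_bounds a; have /andP[C0 C] := oneBcos_le b.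
have hre : `|expR a * cos b - 1 - a| <= (b ^+ 2 / 2 + a ^+ 2) * N.
  have -> : expR a * cos b - 1 - a = (expR a - 1 - a) - expR a * (1 - cos b) by ring.
  apply: le_trans (ler_normB _ _) _; rewrite (ger0_norm B0) ger0_norm; last first.
    by rewrite mulr_ge0// expR_ge0.
  have s1 : expR a * (1 - cos b) <= N * (b ^+ 2 / 2).
    by apply: ler_pM => //; lra.
  have : a ^+ 2 * expR `|a| <= a ^+ 2 * N by rewrite ler_wpM2l ?sqr_ge0.
  by lra.
have ha : `|expR a - 1| <= `|a| * N.
  have [a0|a0] := leP 0 a.
    rewrite !ger0_norm//; last by rewrite subr_ge0 -[leLHS]expR0 ler_expR.
    have h2 := expR_ge1Dx (- a).
    have E : expR a * expR (- a) = 1 by rewrite -expRD subrr expR0.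
    have : expR a - 1 <= a * expR a by nra.
    by nra.
  have : expR a - 1 <= 0 by rewrite subr_le0 -[leRHS]expR0 ler_expR ltW.
  by move=> e0; rewrite (ler0_norm e0) (ltr0_norm a0); nra.
have him : `|expR a * sin b - b| <= `|a| * N * `|b| + b ^+ 2 * N.
  have -> : expR a * sin b - b = (expR a - 1) * sin b + (sin b - b) by ring.
  apply: le_trans (ler_normD _ _) _; rewrite normrM; apply: lerD.
    by apply: ler_pM => //; exact: normr_sin_le.
  apply: le_trans (normr_sinB_le _) _; rewrite ler_peMr ?sqr_ge0//; lra.
have N1 : 1 <= N by lra.
(* The mixed term satisfies |a| |b| <= (a^2 + b^2) / 2. The bounds then add up to (3/2) a^2 + 2 b^2
   times [N], whence the constant 2. *)
have := sqr_ge0 (`|a| - `|b|); rewrite sqrrB !real_normK ?num_real// => hab.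
have : `|a| * N * `|b| <= (a ^+ 2 + b ^+ 2) / 2 * N.
  by rewrite mulrAC ler_wpM2r//; [lra|lra].
have := sqr_ge0 a; have := sqr_ge0 b; nra.
Qed.

End Exponential.

(** * The Gamma function on the right half-plane: convergence, lower bound, functional equation *)

Section Gamma.
Variable R : realType.
Implicit Types (x y c : R) (z w : R[i]).

Definition euler_gamma (n : nat) z : R[i] :=
  n`!%:R * cpow_nat n z / \prod_(k < n.+1) (z + k%:R).

(** Both bounds are ln (1 + t) <= t, at t = 1/(n+1) for the upper one and at t = -1/(n+2) for the
    lower one. *)
Lemma lnS_increment n :
  n.+2%:R^-1 <= (ln n.+2%:R - ln n.+1%:R : R) <= n.+1%:R^-1.
Proof.
have n1 : 0 < n.+1%:R :> R by rewrite ltr0n.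
have n2 : 0 < n.+2%:R :> R by rewrite ltr0n.
have E : n.+2%:R = n.+1%:R + 1 :> R by rewrite -natr1.
have <- : ln (n.+2%:R / n.+1%:R) = ln n.+2%:R - ln n.+1%:R :> R by rewrite ln_div.
apply/andP; split.
- rewrite -[X in _ <= ln X]invrK invf_div lnV ?posrE ?divr_gt0// lerNr.
  have -> : n.+1%:R / n.+2%:R = 1 + - n.+2%:R^-1 :> R by rewrite E; field; lra.
  apply: le_ln1Dx; rewrite ltrN2 invf_lt1// E; lra.
- have -> : n.+2%:R / n.+1%:R = 1 + n.+1%:R^-1 :> R by rewrite E; field; lra.
  by apply: le_ln1Dx; apply: lt_le_trans (_ : 0 <= _) ; rewrite ?ltrN10 ?invr_ge0 ?ltW.
Qed.

Lemma cpow_natS n z : cpow_nat n.+2 z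
  = cpow_nat n.+1 z * cexp (z * (ln n.+2%:R - ln n.+1%:R)%:C%C).
Proof. by rewrite /cpow_nat -cexpD -mulrDr -rmorphD /= subrKC. Qed.

Lemma cpow_natD1 n z : cpow_nat n.+1 (z + 1) = cpow_nat n.+1 z * n.+1%:R.
Proof.
rewrite /cpow_nat mulrDl mul1r cexpD cexp_real lnK ?posrE ?ltr0n//.
by rewrite rmorph_nat.
Qed.

Lemma Re_gt0_addn_neq0 z n : 0 < complex.Re z -> z + n%:R != 0.
Proof.
move=> z0; apply/eqP => /(congr1 (@complex.Re R)); rewrite ReD Re_nat /= => /eqP.
by rewrite gt_eqF// ltr_wpDr.
Qed.

Lemma Re_gt0_neq0 z : 0 < complex.Re z -> z != 0.
Proof. by move=> /(@Re_gt0_addn_neq0 _ 0); rewrite addr0. Qed.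

Lemma prod_addn_neq0 z n : 0 < complex.Re z -> \prod_(k < n) (z + k%:R) != 0.
Proof. by move=> z0; apply/prodf_neq0 => k _; exact: Re_gt0_addn_neq0. Qed.

(** The recurrence starts at index 1, because [cpow_nat 0 z] involves the default value [ln 0]. *)
Lemma euler_gammaS n z : 0 < complex.Re z ->
  euler_gamma n.+2 z = euler_gamma n.+1 z *
    (n.+2%:R * cexp (z * (ln n.+2%:R - ln n.+1%:R)%:C%C) / (z + n.+2%:R)).
Proof.
move=> z0; rewrite /euler_gamma cpow_natS big_ord_recr /= factS natrM.
have := prod_addn_neq0 n.+2 z0; have := Re_gt0_addn_neq0 n.+2 z0.
move: (cexp _) (\prod_(k < n.+2) _) (n.+2%:R : R[i]) => e p m h1 h2; field.
by rewrite h1 h2.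
Qed.

Lemma ler_natr_normcD n z : 0 <= complex.Re z -> n%:R <= normc (z + n%:R).
Proof.
move=> z0; apply: le_trans (Re_le_normc _).
by rewrite ReD Re_nat lerDr.
Qed.

Lemma is_cvg_euler_gamma z : 0 < complex.Re z ->
  cvgn (fun n => euler_gamma n z : R[i]^o).
Proof.
move=> z0.
(* The first summand pays for the Taylor remainder of [cexp (z * w)], where [w] is the increment of
   the logarithm; the second pays for replacing [w] by 1/(n+2). *)
pose D := 4 * normc z ^+ 2 * expR (normc z) + normc z.
have D0 : 0 <= D by rewrite addr_ge0 ?mulr_ge0 ?expR_ge0 ?normc_ge0 ?sqr_ge0.
suff /cvg_ex[l hl] : cvgn (fun n => euler_gamma n.+1 z : R[i]^o).
  by apply/cvg_ex; exists l; rewrite -cvg_shiftS.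
apply: (is_cvgc_ratio D0) => n.
rewrite euler_gammaS// -{2}[euler_gamma _ _]mulr1 -mulrBr normcM mulrC.
rewrite ler_wpM2r ?normc_ge0//.
have /andP[w1 w2] := lnS_increment n.
move: (ln _ - ln _) w1 w2 => w w1 w2.
have zn0 := Re_gt0_addn_neq0 n.+2 z0.
(* With m = n+2, the 1 is absorbed as m/(z+m) times 1 + z/m. The prefactor m/(z+m) has modulus at
   most 1, and the bracket is a Taylor remainder plus z (w - 1/m). *)
have -> : n.+2%:R * cexp (z * w%:C%C) / (z + n.+2%:R) - 1
   = (n.+2%:R / (z + n.+2%:R)) * ((cexp (z * w%:C%C) - 1 - z * w%:C%C)
       + z * (w - n.+2%:R^-1)%:C%C).
  rewrite rmorphB /= fmorphV rmorph_nat /=.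
  have : n.+2%:R != 0 :> R[i] by rewrite pnatr_eq0.
  by move: (n.+2%:R : R[i]) zn0 => m zm0 m0; field; rewrite zm0 m0.
have n1 : 1 <= n.+1%:R :> R by rewrite ler1n.
have E : n.+2%:R = n.+1%:R + 1 :> R by rewrite -natr1.
rewrite normcM -[leRHS]mul1r.
apply: ler_pM; rewrite ?normc_ge0//.
  rewrite normcM normcV normc_nat ler_pdivrMr ?normc_gt0// mul1r.
  exact: ler_natr_normcD (ltW z0).
apply: le_trans (ler_normcD _ _) _; rewrite mulrDl; apply: lerD; last first.
  rewrite normcM normcR ler_wpM2l ?normc_ge0// ger0_norm ?lerD2r//.
  by rewrite subr_ge0.
apply: le_trans (cexp_taylor1 _) _.
have w0 : 0 <= w by apply: le_trans w1; rewrite invr_ge0.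
have W1 : w <= 1 by apply: le_trans w2 _; rewrite invf_le1//; lra.
rewrite normcM normcR (ger0_norm w0) exprMn.
have e1 : expR (normc z * w) <= expR (normc z).
  by rewrite ler_expR ler_piMr// normc_ge0.
(* Indeed w^2 <= 1/(n+1)^2 <= 2/((n+1)(n+2)), since n+2 <= 2(n+1). *)
have ww : w ^+ 2 <= 2 * (n.+1%:R^-1 - n.+2%:R^-1).
  apply: (@le_trans _ _ (n.+1%:R^-1 ^+ 2)).
    by rewrite ler_pXn2r// nnegrE// invr_ge0//; lra.
  have -> : 2 * (n.+1%:R^-1 - n.+2%:R^-1) = 2 / (n.+1%:R * n.+2%:R) :> R.
    by rewrite E; field; lra.
  rewrite exprVn -[leLHS]mul1r ler_pdivrMr ?exprn_gt0 ?ltr0n//.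
  rewrite mulrAC ler_pdivlMr; last by rewrite mulr_gt0// ltr0n.
  rewrite E; nra.
have -> : 4 * normc z ^+ 2 * expR (normc z) * (n.+1%:R^-1 - n.+2%:R^-1)
  = 2 * (normc z ^+ 2 * (2 * (n.+1%:R^-1 - n.+2%:R^-1))) * expR (normc z) by ring.
apply: ler_pM => //; rewrite ?expR_ge0 ?mulr_ge0 ?normc_ge0 ?sqr_ge0//.
by rewrite ler_wpM2l// ler_wpM2l// sqr_ge0.
Qed.

Lemma cvg_euler_gamma z : 0 < complex.Re z ->
  ((fun n => euler_gamma n z : R[i]^o) @ \oo --> (cGamma z : R[i]^o))%classic.
Proof. exact: is_cvg_euler_gamma. Qed.

(* Factor [z + m] as [(x + m) (1 + i y / (x + m))] and use [1 + t <= expR t] on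
   both factors; the exponents [x / m] are absorbed by [cpow_nat], the others
   are dominated by a telescoping sum. *)
Lemma normc_euler_gamma_mono z n : 0 < complex.Re z ->
  normc (euler_gamma n.+1 z)
    * expR (- (complex.Im z ^+ 2 / (complex.Re z + n.+1%:R))) <=
  normc (euler_gamma n.+2 z)
    * expR (- (complex.Im z ^+ 2 / (complex.Re z + n.+2%:R))).
Proof.
move=> z0; rewrite euler_gammaS// [in leRHS]normcM -mulrA.
rewrite ler_wpM2l ?normc_ge0//.
have /andP[w1 _] := lnS_increment n.
move: (ln _ - ln _) w1 => w w1.
rewrite 2!normcM normcV normc_nat normc_cexp.
have -> : complex.Re (z * w%:C%C) = complex.Re z * w.
  by case: (z) => a b /=; ring.
have n1 : 1 <= n.+1%:R :> R by rewrite ler1n.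
have E : n.+2%:R = n.+1%:R + 1 :> R by rewrite -natr1.
set x := complex.Re z in z0 *; set y := complex.Im z.
rewrite [leRHS]mulrAC ler_pdivlMr ?normc_gt0 ?Re_gt0_addn_neq0//.
have xn : 0 < x + n.+2%:R by rewrite E; lra.
have hn : normc (z + n.+2%:R)
    <= (n.+2%:R * expR (x * w)) * expR (y ^+ 2 / (x + n.+2%:R) ^+ 2).
  apply: (@le_trans _ _ ((x + n.+2%:R) * (1 + y ^+ 2 / (x + n.+2%:R) ^+ 2))).
    have -> : z + n.+2%:R = Complex (x + n.+2%:R) y.
      rewrite -(rmorph_nat (real_complex R)) /x /y.
      by case: (z) => a b; rewrite /= -[LHS]/(Complex (a + n.+2%:R) (b + 0)) addr0.
    move: (x + n.+2%:R) xn => X X0 /=.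
    have Y0 : 0 <= y ^+ 2 / X ^+ 2 by rewrite divr_ge0 ?sqr_ge0.
    have Y1 : y ^+ 2 = X ^+ 2 * (y ^+ 2 / X ^+ 2) by field; lra.
    rewrite -[leRHS]ger0_norm; last by rewrite mulr_ge0; lra.
    rewrite -sqrtr_sqr ler_wsqrtr// exprMn {1}Y1.
    by have := sqr_ge0 X; nra.
  apply: ler_pM; rewrite ?expR_ge1Dx ?(ltW xn)//.
    by rewrite addr_ge0// divr_ge0// sqr_ge0.
  have -> : x + n.+2%:R = n.+2%:R * (1 + x / n.+2%:R) by field; lra.
  rewrite ler_wpM2l//; apply: le_trans (expR_ge1Dx _) _.
  by rewrite ler_expR ler_wpM2l// ltW.
apply: (le_trans (ler_wpM2l (expR_ge0 _) hn)).
rewrite mulrCA -expRD ler_wpM2l ?mulr_ge0 ?expR_ge0// ler_expR E addrA.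
have : 0 < x + n.+1%:R by lra.
move: (x + n.+1%:R) => X X0.
rewrite -subr_ge0.
have -> : - (y ^+ 2 / (X + 1)) - (- (y ^+ 2 / X) + y ^+ 2 / (X + 1) ^+ 2)
  = y ^+ 2 / (X * (X + 1) ^+ 2) by field; apply/andP; split; lra.
by rewrite divr_ge0 ?sqr_ge0// mulr_ge0 ?sqr_ge0 ?ltW.
Qed.

(** A crude bound at one fixed index, from which the monotonicity is started: the factorial is at
    least 1, and each of the K+2 factors of the denominator has modulus at most |z| + K + 1. *)
Lemma normc_euler_gamma_ge z K : 0 < complex.Re z ->
  expR (complex.Re z * ln K.+1%:R) / (normc z + K.+1%:R) ^+ K.+2
  <= normc (euler_gamma K.+1 z).
Proof.
move=> z0; rewrite /euler_gamma 2!normcM normcV normc_nat /cpow_nat normc_cexp.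
have -> : complex.Re (z * (ln K.+1%:R)%:C%C) = complex.Re z * ln K.+1%:R.
  by case: (z) => a b /=; ring.
have p0 : 0 < \prod_(k < K.+2) normc (z + k%:R).
  by apply: prodr_gt0 => k _; rewrite normc_gt0 Re_gt0_addn_neq0.
rewrite (normc_prod K.+2 (fun k => z + k%:R)).
have P0 : 0 < normc z + K.+1%:R by rewrite ltr_wpDl ?normc_ge0 ?ltr0n.
apply: ler_pM; rewrite ?expR_ge0 ?invr_ge0 ?exprn_ge0 ?(ltW P0)//.
  by rewrite ler_peMl ?expR_ge0// ler1n fact_gt0.
rewrite lef_pV2 ?posrE ?exprn_gt0//.
rewrite -[K.+2 in leRHS]card_ord -prodr_const; apply: ler_prod => k _.
rewrite normc_ge0 /=; apply: le_trans (ler_normcD _ _) _.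
by rewrite normc_nat lerD2l ler_nat -ltnS.
Qed.

(** The corrected moduli [h] increase and lie below the moduli of Euler's sequence, so the value of
    [h] at [K] bounds the limit from below. On the cone, the correction exponent y^2/(x+K+1) is at
    most c^2 x. *)
Lemma normc_cGamma_ge z c K : 0 < complex.Re z ->
  `|complex.Im z| <= c * complex.Re z ->
  ((normc z + K.+1%:R) ^+ K.+2 * expR ((c ^+ 2 - ln K.+1%:R) * complex.Re z))^-1
  <= normc (cGamma z).
Proof.
move=> z0 yc; pose h n := normc (euler_gamma n.+1 z)
  * expR (- (complex.Im z ^+ 2 / (complex.Re z + n.+1%:R))).
have hmono : {homo h : n m / (n <= m)%N >-> n <= m}.
  by apply/nondecreasing_seqP => n; exact: normc_euler_gamma_mono.
apply: (normc_cvg_ge (N := K.+1) (cvg_euler_gamma z0)) => -[//|n] Kn.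
have hn : h n <= normc (euler_gamma n.+1 z).
  rewrite ler_piMr ?normc_ge0// -[leRHS]expR0 ler_expR oppr_le0.
  by rewrite divr_ge0 ?sqr_ge0 ?addr_ge0 ?(ltW z0).
apply: le_trans (hn); apply: le_trans (hmono _ _ (_ : (K <= n)%N)) => //.
apply: le_trans (ler_wpM2r (expR_ge0 _) (normc_euler_gamma_ge K z0)).
have -> : (c ^+ 2 - ln K.+1%:R) * complex.Re z
  = - (complex.Re z * ln K.+1%:R + - (c ^+ 2 * complex.Re z)) by ring.
rewrite invfM -expRN opprK expRD mulrCA mulrA mulrAC [leRHS]mulrAC.
rewrite ler_wpM2r ?invr_ge0 ?exprn_ge0 ?addr_ge0 ?normc_ge0//.
rewrite ler_wpM2l ?expR_ge0// ler_expR lerN2.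
have X0 : 0 < complex.Re z + K.+1%:R by rewrite ltr_wpDr.
have K0 : 0 <= K.+1%:R :> R by [].
rewrite ler_pdivrMr//.
have := normr_ge0 (complex.Im z); rewrite -[_ ^+ 2]real_normK ?num_real//.
move: (complex.Re z) `|complex.Im z| (K.+1%:R : R) z0 yc K0 X0 {hmono hn h}.
move=> x y m x0 yc m0 xm y0.
have : y ^+ 2 <= (c * x) ^+ 2 by rewrite ler_pXn2r// nnegrE; lra.
have := mulr_ge0 (mulr_ge0 (sqr_ge0 c) (ltW x0)) m0.
by rewrite exprMn; nra.
Qed.

Lemma cGamma_neq0 z : 0 < complex.Re z -> cGamma z != 0.
Proof.
move=> z0; rewrite -normc_gt0.
(* Every point of the open right half-plane lies on a cone, here with slope |y|/x; any [K] then
   gives a positive lower bound. *)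
have yc : `|complex.Im z| <= `|complex.Im z| / complex.Re z * complex.Re z.
  by rewrite divfK// gt_eqF.
apply: lt_le_trans (normc_cGamma_ge 0 z0 yc).
by rewrite invr_gt0 mulr_gt0 ?expR_gt0 ?exprn_gt0// ltr_wpDl ?normc_ge0.
Qed.

(** Euler's sequence satisfies the equation up to the factor (n+1)/(z+n+2), which tends to 1;
    uniqueness of limits concludes. *)
Lemma cGammaD1 z : 0 < complex.Re z -> cGamma (z + 1) = z * cGamma z.
Proof.
move=> z0; have z10 : 0 < complex.Re (z + 1).
  by rewrite ReD /= ltr_wpDr.
have E n : euler_gamma n.+1 (z + 1)
  = (z * euler_gamma n.+1 z) * (n.+1%:R / (z + n.+2%:R)).
  rewrite /euler_gamma cpow_natD1.
  have := prod_addn_neq0 n.+2 z10; have := prod_addn_neq0 n.+2 z0.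
  (* Both sides are z (z+1) ... (z+n+2), with the first or the last factor split off. *)
  have : z * \prod_(k < n.+2) (z + 1 + k%:R)
       = \prod_(k < n.+2) (z + k%:R) * (z + n.+2%:R).
    transitivity (\prod_(k < n.+3) (z + k%:R)); last by rewrite big_ord_recr.
    rewrite [RHS]big_ord_recl /= addr0.
    by congr (_ * _); apply: eq_bigr => k _; rewrite -addrA -natr1 [1 + _]addrC.
  have := Re_gt0_addn_neq0 n.+2 z0; have := Re_gt0_neq0 z0.
  move: (\prod_(k < n.+2) (z + 1 + k%:R)) (\prod_(k < n.+2) (z + k%:R)).
  move: (n.+2%:R : R[i]) (n.+1%:R : R[i]) (n.+1`!%:R : R[i]) (cpow_nat _ _).
  move=> m m' f g p q z1 zm pq q0 p0.
  have -> : p = z^-1 * (q * (z + m)) by rewrite -pq mulKf.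
  by field; rewrite z1 zm q0.
have ratio : ((fun n => n.+1%:R / (z + n.+2%:R) : R[i]^o) @ \oo --> (1 : R[i]^o))%classic.
  apply: (@cvgc_of_le _ _ _ (fun n => normc (z + 1) * n.+1%:R^-1)).
    move=> n; have zn := Re_gt0_addn_neq0 n.+2 z0.
    have -> : n.+1%:R / (z + n.+2%:R) - 1 = - ((z + 1) / (z + n.+2%:R)).
      by move: zn; rewrite -[n.+2%:R]natr1; move: (n.+1%:R : R[i]) => m zn; field.
    rewrite normc_opp normcM normcV ler_wpM2l ?normc_ge0//.
    rewrite lef_pV2 ?posrE ?normc_gt0 ?ltr0n//.
    apply: le_trans (ler_natr_normcD n.+2 (ltW z0)).
    by rewrite ler_nat.
  rewrite -(mulr0 (normc (z + 1))).
  by apply: cvgM; [exact: cvg_cst|exact: cvg_harmonic].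
have h := cvgcM (cvgcMl (c := z) (cvgcS (cvg_euler_gamma z0))) ratio.
rewrite mulr1 in h; apply: (cvgc_unique _ h).
rewrite -(funext E : (fun n => euler_gamma n.+1 (z + 1) : R[i]^o) = _).
exact: cvgcS (cvg_euler_gamma z10).
Qed.

End Gamma.

(** * The complex Prabhakar function: convergence and the two identities *)

Section ComplexPrabhakar.
Variable R : realType.
Implicit Types (s t d z : R[i]) (k n : nat).

Definition cprabhakar_term s t d z k : R[i]^o :=
  \prod_(i < k) (d + i%:R) / (k`!%:R * cGamma (s * k%:R + t)) * z ^+ k.

Definition cprabhakar s t d z : R[i] := limn (series (cprabhakar_term s t d z)).

Lemma pochS d n :
  \prod_(i < n.+1) (d + i%:R) = \prod_(i < n) (d + i%:R) * (d + n%:R).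
Proof. by rewrite big_ord_recr. Qed.

Lemma pochSl d n :
  \prod_(i < n.+1) (d + i%:R) = d * \prod_(i < n) (d + 1 + i%:R).
Proof.
rewrite big_ord_recl /= addr0; congr (_ * _); apply: eq_bigr => i _.
by rewrite -addrA -natr1 [1 + _]addrC.
Qed.

(** Each factor satisfies |d + k| <= (k+1)(1 + |d|), so after division by k! the Pochhammer symbol
    grows at most geometrically. *)
Lemma normc_poch_le d k :
  normc (\prod_(i < k) (d + i%:R)) <= k`!%:R * (1 + normc d) ^+ k.
Proof.
elim: k => [|k IH]; first by rewrite big_ord0 normc1 mulr1.
rewrite pochS normcM factS natrM exprSr.
have -> : k.+1%:R * k`!%:R * ((1 + normc d) ^+ k * (1 + normc d))
  = (k`!%:R * (1 + normc d) ^+ k) * (k.+1%:R * (1 + normc d)) by ring.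
apply: ler_pM; rewrite ?normc_ge0//; apply: le_trans (ler_normcD _ _) _.
rewrite normc_nat -natr1; have := normc_ge0 d; have : 0 <= k%:R :> R by [].
nra.
Qed.

Lemma Re_muln_addr_gt0 s t k : 0 < complex.Re s -> 0 < complex.Re t ->
  0 < complex.Re (s * k%:R + t).
Proof. by move=> s0 t0; rewrite ReD ReMn ltr_wpDl// mulr_ge0// ltW. Qed.

Lemma cGamma_muln_addr_neq0 s t k : 0 < complex.Re s -> 0 < complex.Re t ->
  k`!%:R * cGamma (s * k%:R + t) != 0.
Proof.
move=> s0 t0; apply: mulf_neq0; first by rewrite pnatr_eq0 -lt0n fact_gt0.
exact: cGamma_neq0 (Re_muln_addr_gt0 k s0 t0).
Qed.

(** A single term of the exponential series at k+1 is at most e^(k+1). This turns the polynomial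
    factor in the bound for 1/Gamma into a geometric one. *)
Lemma exprS_le_fact_expR m k :
  k.+1%:R ^+ m.+1 <= m.+1`!%:R * expR 1 * expR 1 ^+ k :> R.
Proof.
have := @expR_ge1Dxn R k.+1%:R m (ler0n _ _).
rewrite -mulrA -exprS -expRM_natr mul1r => h.
rewrite mulrC -ler_pdivrMr ?ltr0n ?fact_gt0//; lra.
Qed.

(** The terms are dominated by [C * q ^+ k], and the free index [K] of the Gamma bound is chosen to
    force [q < 1]. *)
Lemma is_cvg_cprabhakar s t d z : 0 < complex.Re s -> 0 < complex.Re t ->
  cvgn (series (cprabhakar_term s t d z)).
Proof.
move=> s0 t0.
(* The sum of the slopes of [s] and [t]: both lie on the cone of slope [c], hence so does
   [s * k%:R + t] for every [k]. *)
pose c := `|complex.Im s| / complex.Re s + `|complex.Im t| / complex.Re t.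
(* The geometric rates of the Pochhammer quotient, of the power of [z] and of the polynomial factor
   in the Gamma bound. *)
pose Q := (1 + normc d) * normc z * expR 1.
have d0 := normc_ge0 d; have z0 := normc_ge0 z.
have Q0 : 0 <= Q by rewrite !mulr_ge0 ?expR_ge0//; lra.
(* This makes ln (K+1) at least c^2 + Q / Re s, so that [L * complex.Re s <= - Q] and q <= Q e^(-Q)
   < 1. *)
pose K := Num.truncn (expR (c ^+ 2 + Q / complex.Re s)).
pose L := c ^+ 2 - ln K.+1%:R.
have LQ : L * complex.Re s <= - Q.
  have : c ^+ 2 + Q / complex.Re s <= ln K.+1%:R.
    by rewrite -[leLHS]expRK ler_ln ?posrE ?expR_gt0 ?ltr0n// ltW// truncnS_gt.
  by move=> h; rewrite -ler_pdivlMr// mulNr /L; lra.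
clearbody K.
pose q := Q * expR (L * complex.Re s).
have q0 : 0 <= q by rewrite mulr_ge0 ?expR_ge0.
have q1 : q < 1.
  apply: (@le_lt_trans _ _ (Q * expR (- Q))); first by rewrite ler_wpM2l ?ler_expR.
  rewrite expRN ltr_pdivrMr ?expR_gt0// mul1r.
  by have := expR_ge1Dx Q; lra.
(* Chosen so that |s k + t| + K + 1 <= A (k+1). *)
pose A := normc s + normc t + K.+1%:R.
pose C := A ^+ K.+2 * (K.+2`!%:R * expR 1) * expR (L * complex.Re t).
apply: (@is_cvgc_series _ _ (geometric C q)); last first.
  by apply: is_cvg_geometric_series; rewrite ger0_norm.
move=> k; rewrite /geometric /= /cprabhakar_term.
have w0 := Re_muln_addr_gt0 k s0 t0; set w := s * k%:R + t in w0 *.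
have wc : `|complex.Im w| <= c * complex.Re w.
  rewrite /w ImD ReD ImMn ReMn; apply: le_trans (ler_normD _ _) _.
  rewrite normrM normr_nat.
  have a0 : 0 <= `|complex.Im s| / complex.Re s by rewrite divr_ge0// ltW.
  have b0 : 0 <= `|complex.Im t| / complex.Re t by rewrite divr_ge0// ltW.
  have -> : `|complex.Im s| = `|complex.Im s| / complex.Re s * complex.Re s.
    by rewrite divfK// gt_eqF.
  have -> : `|complex.Im t| = `|complex.Im t| / complex.Re t * complex.Re t.
    by rewrite divfK// gt_eqF.
  rewrite mulrDr /c -[_ / _ * _ * k%:R]mulrA.
  have sk : 0 <= complex.Re s * k%:R by rewrite mulr_ge0// ltW.
  move: (`|complex.Im s| / _) (`|complex.Im t| / _) a0 b0 => a b a0 b0.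
  by apply: lerD; rewrite ler_wpM2r ?(ltW t0)//; lra.
have := normc_cGamma_ge K w0 wc; rewrite -/L => gw.
have g0 : 0 < normc (cGamma w) by rewrite normc_gt0 cGamma_neq0.
have k0 : 0 < k`!%:R :> R by rewrite ltr0n fact_gt0.
have A0 : 0 <= A by rewrite !addr_ge0 ?normc_ge0.
have wA : normc w + K.+1%:R <= A * k.+1%:R.
  have := ler_normcD (s * k%:R) t; rewrite -/w normcM normc_nat.
  have kn : 0 <= k%:R :> R by [].
  have sp := normc_ge0 s; have tk := mulr_ge0 (normc_ge0 t) kn.
  have Kk : 0 <= K.+1%:R * k%:R :> R by rewrite mulr_ge0.
  rewrite /A -[k.+1%:R]natr1; move: (K.+1%:R : R) Kk => M; lra.
have w1 : 0 < normc w + K.+1%:R by rewrite ltr_wpDl ?normc_ge0 ?ltr0n.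
have gV : (normc (cGamma w))^-1 <= C * (expR 1 * expR (L * complex.Re s)) ^+ k.
  rewrite -[leLHS]mul1r ler_pdivrMr// mulrC.
  move: gw; set P := _ * _ => gw.
  have P0 : 0 < P by rewrite mulr_gt0 ?exprn_gt0 ?expR_gt0.
  have PC : P <= C * (expR 1 * expR (L * complex.Re s)) ^+ k.
    have -> : C * (expR 1 * expR (L * complex.Re s)) ^+ k
      = (A ^+ K.+2 * (K.+2`!%:R * expR 1 * expR 1 ^+ k))
        * expR (L * complex.Re w).
      rewrite ReD ReMn [L * (_ + _)]mulrDr [L * (_ * _)]mulrA expRD.
      rewrite [expR (_ * k%:R)]expRM_natr exprMn /C.
      move: (A ^+ K.+2) (K.+2`!%:R : R) (expR (L * complex.Re t)).
      move: (expR 1 ^+ k) (expR (L * complex.Re s) ^+ k) => u v.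
      by move: (expR 1) => e a f g; ring.
    rewrite ler_wpM2r ?expR_ge0//.
    apply: (@le_trans _ _ ((A * k.+1%:R) ^+ K.+2)).
      by rewrite lerXn2r// nnegrE ?mulr_ge0// ltW.
    by rewrite exprMn ler_wpM2l ?exprn_ge0// exprS_le_fact_expR.
  apply: (@le_trans _ _ (P^-1 * P)); first by rewrite mulVf// gt_eqF.
  by apply: ler_pM; rewrite ?invr_ge0 ?(ltW P0).
rewrite 2!normcM normcV normcM normc_nat normcX invfM.
have pk := normc_poch_le d k.
apply: (@le_trans _ _ ((1 + normc d) ^+ k *
  (C * (expR 1 * expR (L * complex.Re s)) ^+ k) * normc z ^+ k)).
  rewrite ler_wpM2r ?exprn_ge0// mulrA.
  apply: ler_pM; rewrite ?divr_ge0 ?normc_ge0 ?invr_ge0 ?(ltW k0) ?(ltW g0)//.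
  by rewrite ler_pdivrMr// mulrC.
rewrite le_eqVlt; apply/orP; left; apply/eqP; rewrite /q /Q !exprMn.
by move: (C) (expR (L * _)) => C' f; ring.
Qed.

Lemma cvg_cprabhakar s t d z : 0 < complex.Re s -> 0 < complex.Re t ->
  (series (cprabhakar_term s t d z) @ \oo --> (cprabhakar s t d z : R[i]^o))%classic.
Proof. exact: is_cvg_cprabhakar. Qed.

Lemma cprabhakar_shift s t d z : 0 < complex.Re s -> 0 < complex.Re t ->
  z * cprabhakar s (s + t) d z = cprabhakar s t d z - cprabhakar s t (d - 1) z.
Proof.
move=> s0 t0; have st0 : 0 < complex.Re (s + t) by rewrite ReD addr_gt0.
(* The right-hand sums have one term more: their terms of index 0 cancel, and index k on the left
   matches k+1 on the right because s (k+1) + t = s k + (s + t). *)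
have E n : z * series (cprabhakar_term s (s + t) d z) n
  = series (cprabhakar_term s t d z) n.+1 - series (cprabhakar_term s t (d - 1) z) n.+1.
  elim: n => [|n IH].
    rewrite 2!seriesSr /series /= !big_geq// mulr0 /cprabhakar_term !big_ord0.
    by rewrite subrr.
  rewrite seriesSr mulrDr IH ![series _ n.+2]seriesSr opprD addrACA; congr (_ + _).
  (* Splitting off the last factor of one symbol and the first of the other leaves the common factor
     (d)_n; the cofactors differ by (d + n) - (d - 1) = n + 1, which cancels against (n+1)!. *)
  rewrite /cprabhakar_term (pochS d) (pochSl (d - 1)) subrK.
  have g0 := cGamma_muln_addr_neq0 n s0 st0.
  have -> : s * n.+1%:R + t = s * n%:R + (s + t) by rewrite -natr1; ring.
  have n0 : n.+1%:R != 0 :> R[i] by rewrite pnatr_eq0.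
  move: g0; rewrite factS natrM exprS mulf_eq0 negb_or => /andP[f0 g0].
  have -> : d + n%:R = d - 1 + n.+1%:R by rewrite -natr1; ring.
  move: (n.+1%:R : R[i]) n0 (n`!%:R : R[i]) f0 (cGamma _) g0 (\prod_(i < n) _).
  by move=> m m0 f f0 g g0 p; field; rewrite m0 f0 g0.
apply: (cvgc_unique (cvgcMl (c := z) (cvg_cprabhakar s0 st0))).
rewrite (funext E : (fun n => z * series _ n) = _).
exact: cvgcB (cvgcS (cvg_cprabhakar s0 t0)) (cvgcS (cvg_cprabhakar s0 t0)).
Qed.

Lemma cprabhakar_contiguous s t d z : 0 < complex.Re s -> 1 < complex.Re t ->
  (t - s * d - 1) * cprabhakar s t d z
  = cprabhakar s (t - 1) d z - s * d * cprabhakar s t (d + 1) z.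
Proof.
move=> s0 t1; have t0 : 0 < complex.Re t by lra.
have t10 : 0 < complex.Re (t - 1).
  by move: t1; case: (t) => a b /=; rewrite subr_gt0.
have E n : (t - s * d - 1) * series (cprabhakar_term s t d z) n
  = series (cprabhakar_term s (t - 1) d z) n
    - s * d * series (cprabhakar_term s t (d + 1) z) n.
  elim: n => [|n IH]; first by rewrite /series /= !big_geq// !mulr0 subr0.
  rewrite !seriesSr !mulrDr IH opprD addrACA; congr (_ + _).
  have := pochSl d n; rewrite pochS /cprabhakar_term.
  (* With w = s n + t - 1, whose real part is positive, all three terms are expressed through Gamma
     w; the coefficients agree because w - s (d + n) = t - s d - 1. *)
  have -> : s * n%:R + t = s * n%:R + (t - 1) + 1 by ring.
  have w0 := Re_muln_addr_gt0 n s0 t10.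
  rewrite cGammaD1//; have := Re_gt0_neq0 w0; have := cGamma_neq0 w0.
  have : n`!%:R != 0 :> R[i] by rewrite pnatr_eq0 -lt0n fact_gt0.
  move: (\prod_(i < n) (d + 1 + i%:R)) (\prod_(i < n) (d + i%:R)) (cGamma _).
  move: (n`!%:R : R[i]) (z ^+ n) => f x p p' g f0 g0 wn pp.
  (* Since [d] may vanish, [pp] is used to replace the product [d * p], without dividing by [d]. *)
  have -> : s * d * (p / (f * ((s * n%:R + (t - 1)) * g)) * x)
    = s * (p' * (d + n%:R)) / (f * ((s * n%:R + (t - 1)) * g)) * x.
    by rewrite pp !mulrA.
  by field; rewrite f0 g0 wn.
apply: (cvgc_unique (cvgcMl (c := t - s * d - 1) (cvg_cprabhakar s0 t0))).
rewrite (funext E : (fun n => (t - s * d - 1) * series _ n) = _).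
exact: cvgcB (cvg_cprabhakar s0 t10) (cvgcMl (c := s * d) (cvg_cprabhakar s0 t0)).
Qed.

End ComplexPrabhakar.

(** * The idempotent coordinates as ring morphisms *)

Section Idempotents.
Variable R : rcfType.
Implicit Types x y : bicomplex R.

Lemma idem1B : zmod_morphism (@idem1 R).
Proof. by move=> [????] [????]; congr Complex => /=; ring. Qed.

Lemma idem2B : zmod_morphism (@idem2 R).
Proof. by move=> [????] [????]; congr Complex => /=; ring. Qed.

HB.instance Definition _ :=
  GRing.isZmodMorphism.Build (bicomplex R) R[i] (@idem1 R) idem1B.
HB.instance Definition _ :=
  GRing.isZmodMorphism.Build (bicomplex R) R[i] (@idem2 R) idem2B.
HB.instance Definition _ :=
  GRing.isMonoidMorphism.Build (bicomplex R) R[i] (@idem1 R) (@idem1_1 R, @idem1M R).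
HB.instance Definition _ :=
  GRing.isMonoidMorphism.Build (bicomplex R) R[i] (@idem2 R) (@idem2_1 R, @idem2M R).

Lemma idem_inj x y : idem1 x = idem1 y -> idem2 x = idem2 y -> x = y.
Proof. by move=> e1 e2; rewrite -[x]of_idemK -[y]of_idemK e1 e2. Qed.

Lemma unit_bicomplexE x :
  (x \is a GRing.unit) = (idem1 x != 0) && (idem2 x != 0).
Proof. by []. Qed.

(** The coordinates have real parts x0 + x3 and x0 - x3. The value a = 0 serves the convergence
    conditions, and a = 1 the stronger condition of (ii). *)
Lemma absImj_lt x (a : R) : `|bImj x| < bRe x - a ->
  a < complex.Re (idem1 x) /\ a < complex.Re (idem2 x).
Proof. by case: x => ? ? ? ? /=; rewrite ltr_norml; lra. Qed.

End Idempotents.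

(** * Reduction of the bicomplex Prabhakar function to the complex one *)

Section BicomplexPrabhakar.
Variable R : realType.
Implicit Types s t d z : bicomplex R.

Lemma idem1_bGamma x : idem1 (bGamma x) = cGamma (idem1 x) :> R[i].
Proof. exact: idem1K. Qed.

Lemma idem2_bGamma x : idem2 (bGamma x) = cGamma (idem2 x) :> R[i].
Proof. exact: idem2K. Qed.

(** Bicomplex numbers have zero divisors, so for the quotients to split componentwise both
    coordinates of the denominator must be nonzero. *)
Lemma bGamma_muln_addr_unit s t k :
  `|bImj s| < bRe s -> `|bImj t| < bRe t ->
  k`!%:R * bGamma (s * k%:R + t) \is a GRing.unit.
Proof.
rewrite -[bRe s]subr0 -[bRe t]subr0 => /absImj_lt[s1 s2] /absImj_lt[t1 t2].
rewrite unit_bicomplexE idem1M idem2M idem1_bGamma idem2_bGamma.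
by rewrite !(rmorphD, rmorphM, rmorph_nat) /= !cGamma_muln_addr_neq0.
Qed.

(** Stated for any morphism compatible with Gamma, so that one proof covers both coordinates. *)
Lemma rmorph_prabhakar_term (f : {rmorphism bicomplex R -> R[i]}) s t d z n :
  (forall x, f (bGamma x) = cGamma (f x)) ->
  `|bImj s| < bRe s -> `|bImj t| < bRe t ->
  f (series (fun k =>
    pochhammer d k / (k`!%:R * bGamma (s * k%:R + t)) * z ^+ k) n)
  = series (cprabhakar_term (f s) (f t) (f d) (f z)) n.
Proof.
move=> fG s0 t0; rewrite /series /= rmorph_sum; apply: eq_bigr => k _.
rewrite rmorphM rmorphM rmorphXn rmorphV ?bGamma_muln_addr_unit//.
rewrite rmorphM fG rmorphD rmorphM !rmorph_nat /pochhammer rmorph_prod.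
rewrite /cprabhakar_term; congr (_ / _ * _).
by apply: eq_bigr => i _; rewrite rmorphD rmorph_nat.
Qed.

Lemma idem_prabhakar s t d z : `|bImj s| < bRe s -> `|bImj t| < bRe t ->
  idem1 (prabhakar s t d z)
    = cprabhakar (idem1 s) (idem1 t) (idem1 d) (idem1 z) /\
  idem2 (prabhakar s t d z)
    = cprabhakar (idem2 s) (idem2 t) (idem2 d) (idem2 z).
Proof.
move=> s0 t0; split; rewrite [LHS](idem1K, idem2K).
- apply: (congr1 (fun u : nat -> R[i]^o => limn u)); apply/funext => n.
  exact: (rmorph_prabhakar_term (f := @idem1 R) d z n idem1_bGamma).
- apply: (congr1 (fun u : nat -> R[i]^o => limn u)); apply/funext => n.
  exact: (rmorph_prabhakar_term (f := @idem2 R) d z n idem2_bGamma).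
Qed.

Lemma absImjD s t : `|bImj s| < bRe s -> `|bImj t| < bRe t ->
  `|bImj (s + t)| < bRe (s + t).
Proof.
case: s t => ? ? ? s3 [? ? ? t3] /= hs ht.
exact: le_lt_trans (ler_normD _ _) (ltrD hs ht).
Qed.

Lemma absImjB1 t : `|bImj t| < bRe t - 1 -> `|bImj (t - 1)| < bRe (t - 1).
Proof. by case: t => ? ? ? ? /=; rewrite subr0. Qed.

End BicomplexPrabhakar.

Theorem theorem3p1 (R : realType) (zeta s t d : bicomplex R)
    (hs : `|bImj s| < bRe s) :
  (`|bImj t| < bRe t ->
     zeta * prabhakar s (s + t) d zeta
     = prabhakar s t d zeta - prabhakar s t (d - 1) zeta) /\
  (`|bImj t| < bRe t - 1 ->
     (t - s * d - 1) * prabhakar s t d zeta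
     = prabhakar s (t - 1) d zeta - s * d * prabhakar s t (d + 1) zeta).
Proof.
have [s1 s2] : 0 < complex.Re (idem1 s) /\ 0 < complex.Re (idem2 s).
  by apply: absImj_lt; rewrite subr0.
split=> ht.
- have [t1 t2] : 0 < complex.Re (idem1 t) /\ 0 < complex.Re (idem2 t).
    by apply: absImj_lt; rewrite subr0.
  have hst := absImjD hs ht.
  have [e1 f1] := idem_prabhakar (d - 1) zeta hs ht.
  have [e2 f2] := idem_prabhakar d zeta hs ht.
  have [e3 f3] := idem_prabhakar d zeta hs hst.
  (* The three values are abstracted so that the morphism laws rewrite only the parameters in the
     coordinate equations. *)
  move: (prabhakar s t (d - 1) zeta) (prabhakar s t d zeta)
    (prabhakar s (s + t) d zeta) e1 f1 e2 f2 e3 f3 => E1 E2 E3.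
  rewrite !(rmorphD, rmorphN, rmorph1) /= => e1 f1 e2 f2 e3 f3.
  apply: idem_inj; rewrite rmorphM rmorphB /=.
  + by rewrite e1 e2 e3; exact: cprabhakar_shift.
  + by rewrite f1 f2 f3; exact: cprabhakar_shift.
- have [t1 t2] := absImj_lt ht.
  have ht1 := absImjB1 ht.
  have ht0 : `|bImj t| < bRe t by rewrite (lt_trans ht)// ltrBlDr ltrDl.
  have [e1 f1] := idem_prabhakar (d + 1) zeta hs ht0.
  have [e2 f2] := idem_prabhakar d zeta hs ht0.
  have [e3 f3] := idem_prabhakar d zeta hs ht1.
  move: (prabhakar s t (d + 1) zeta) (prabhakar s t d zeta)
    (prabhakar s (t - 1) d zeta) e1 f1 e2 f2 e3 f3 => E1 E2 E3.
  rewrite !(rmorphD, rmorphN, rmorph1) /= => e1 f1 e2 f2 e3 f3.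
  apply: idem_inj; rewrite !(rmorphM, rmorphD, rmorphN, rmorph1) /=.
  + by rewrite e1 e2 e3; exact: cprabhakar_contiguous.
  + by rewrite f1 f2 f3; exact: cprabhakar_contiguous.
Qed.
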